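(* Let $k\ge2$ and $r\ge1$. Then $(k,r)\text{-WL}^2_{I}\preceq(k,r)\text{-WL}^2_{II}\preceq(k+2,r+1)\text{-WL}^2_{I}$; that is, for all finite groups $G,H$: if Spoiler has a winning strategy on $G,H$ in the $(k,r)$-WL$^2_I$ game then Spoiler has one in the $(k,r)$-WL$^2_{II}$ game, and if Spoiler has a winning strategy in the $(k,r)$-WL$^2_{II}$ game then Spoiler has one in the $(k+2,r+1)$-WL$^2_I$ game.
   Context: For tuples $\overline{g}\in G^m,\overline{h}\in H^m$: $(\overline{g},\overline{h})$ gives a well-defined map if $g_i=g_j\Leftrightarrow h_i=h_j$ for all $i,j$; a partial isomorphism if moreover $g_ig_j=g_l\Leftrightarrow h_ih_j=h_l$ for all $i,j,l$; a marked isomorphism if well-defined and $g_i\mapsto h_i$ extends to an isomorphism $\langle g_1,\dots,g_m\rangle\to\langle h_1,\dots,h_m\rangle$. The $(k,r)$-WL$^2_J$ game ($J\in\{I,II\}$) on $G,H$: Spoiler and Duplicator, $k$ pebble pairs $(p_i,p_i')$ initially off the board; if $|G|\ne|H|$ Spoiler wins at round $0$. Each round: (1) Spoiler picks up one or two pebble pairs; (2) the winning condition is checked; (3) Duplicator chooses a bijection $f\colon G\to H$; (4) Spoiler places each picked-up $p_i$ on some $v_i\in G$ and $p_i'$ is placed on $f(v_i)$. Spoiler wins if at some check (during the first $r$ rounds, including the configuration after round $r$) the pebbled elements $\overline{v}$ of $G$ and corresponding $\overline{v}'$ of $H$ do not give a partial isomorphism (Version I), respectively a marked isomorphism (Version II).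 *)

(* Defs.v *)
From mathcomp Require Import all_boot all_fingroup.

Set Implicit Arguments.
Unset Strict Implicit.
Unset Printing Implicit Defensive.

Local Open Scope group_scope.

Section MarkedTuples.

Variables (gT hT : finGroupType) (m : nat).
Variables (g : m.-tuple gT) (h : m.-tuple hT).

Definition well_defined_map : Prop :=
  forall i j : 'I_m, tnth g i = tnth g j <-> tnth h i = tnth h j.

Definition partial_isomorphism : Prop :=
  well_defined_map /\
  forall i j l : 'I_m,
    tnth g i * tnth g j = tnth g l <-> tnth h i * tnth h j = tnth h l.

Definition marked_isomorphism : Prop :=
  well_defined_map /\
  exists phi : {morphism <<[set x in g]>> >-> hT},
    isom <<[set x in g]>> <<[set y in h]>> phi /\
    forall i : 'I_m, phi (tnth g i) = tnth h i.

End MarkedTuples.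

Inductive version := VersionI | VersionII.

Section Game.

Variables (k : nat) (gT hT : finGroupType).

(* [c i = Some (v, v')] when p_i lies on v and p_i' on v', and [c i = None]
   when the i-th pebble pair is off the board. *)
Definition configuration := 'I_k -> option (gT * hT).

Definition empty_board : configuration := fun=> None.

Definition pebbled (c : configuration) : seq (gT * hT) := pmap c (enum 'I_k).

Definition good (J : version) (c : configuration) : Prop :=
  let v := map_tuple fst (in_tuple (pebbled c)) in
  let v' := map_tuple snd (in_tuple (pebbled c)) in
  match J with
  | VersionI => partial_isomorphism v v'
  | VersionII => marked_isomorphism v v'
  end.

Definition lift_pebbles (P : {set 'I_k}) (c : configuration) : configuration :=
  fun i => if i \in P then None else c i.

Definition place_pebbles (P : {set 'I_k}) (v : 'I_k -> gT) (f : gT -> hT)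
    (c : configuration) : configuration :=
  fun i => if i \in P then Some (v i, f (v i)) else c i.

(* Against a fixed strategy of Spoiler the whole play is determined by
   Duplicator's bijections, so a strategy only needs to see those chosen so far,
   listed oldest first; [put] also sees the bijection of the current round.
   The values of [put] at pebbles that were not picked up are irrelevant.
   A pebble pair that is off the board may be picked up too. *)
Record strategy := Strategy {
  pick_up : seq {ffun gT -> hT} -> {set 'I_k};
  put : seq {ffun gT -> hT} -> 'I_k -> gT;
  card_pick_up : forall past, 1 <= #|pick_up past| <= 2
}.

(* Spoiler, playing [s], wins the play that continues from configuration [c]
   with Duplicator choosing the bijections [future], after having chosen [past]. *)
Fixpoint wins_play (J : version) (s : strategy) (c : configuration)
    (past future : seq {ffun gT -> hT}) : Prop :=
  match future with
  | [::] => ~ good J c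
  | f :: future' =>
      let P := pick_up s past in
      let c' := lift_pebbles P c in
      let past' := rcons past f in
      ~ good J c' \/
      wins_play J s (place_pebbles P (put s past') f c') past' future'
  end.

End Game.

Definition spoiler_wins (k r : nat) (J : version) (gT hT : finGroupType) : Prop :=
  #|gT| <> #|hT| \/
  exists s : strategy k gT hT,
    forall fs : r.-tuple {ffun gT -> hT},
      (forall f : {ffun gT -> hT}, f \in fs -> bijective f) ->
      wins_play J s (@empty_board k gT hT) [::] fs.

(* Main.v *)
(** A marked isomorphism is a partial isomorphism, which gives the first claim.
    For the second, Spoiler keeps two pebble pairs in reserve and copies a
    winning strategy until the configuration is no longer a marked isomorphism;
    then he picks up the two reserve pairs.  Suppose Duplicator's bijection [f]
    survives every placement of them.  Then [f 1 = 1], [f] extends the pebbled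
    map [g_i |-> h_i], and [f (x * g_i) = f x * f g_i] for all [x], so [f] is an
    injective morphism on the group generated by the [g_i], a contradiction.  A
    violation of these identities involves at most three of the at least four
    pebble pairs, so if a further round is to be played Spoiler can pick up a
    pair that is not involved. *)

Require Import Defs.
From mathcomp Require Import all_boot all_fingroup.
From Stdlib Require Import Classical_Prop.

Set Implicit Arguments.
Unset Strict Implicit.
Unset Printing Implicit Defensive.

Local Open Scope group_scope.

(** * Marked isomorphisms as embeddings of the generated subgroup *)

Lemma mem_pebbled (k : nat) (gT hT : finGroupType)
    (c : configuration k gT hT) (p : gT * hT) :
  reflect (exists i, c i = Some p) (p \in pebbled c).
Proof.
rewrite /pebbled mem_pmap; apply: (iffP mapP) => [[i _ ->]|[i <-]].
  by exists i.
by exists i; rewrite ?mem_enum.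
Qed.

Lemma tnth_pebbled (k : nat) (gT hT : finGroupType)
    (c : configuration k gT hT) (i : 'I_k) (p : gT * hT) :
  c i = Some p -> exists j, tnth (in_tuple (pebbled c)) j = p.
Proof.
move=> ci; have: p \in in_tuple (pebbled c) by apply/mem_pebbled; exists i.
by case/tnthP=> j ->; exists j.
Qed.

Definition pebbled_domain (k : nat) (gT hT : finGroupType)
    (c : configuration k gT hT) : {set gT} := [set x in map fst (pebbled c)].

(** A total function, constrained only on the generated subgroup: it restricts to smaller
    configurations unchanged, and Duplicator's bijection can itself serve as [phi]. *)
Definition marked_embedding (k : nat) (gT hT : finGroupType)
    (c : configuration k gT hT) (phi : gT -> hT) : Prop :=
  [/\ {in <<pebbled_domain c>> &, {morph phi : x y / x * y}},
      {in <<pebbled_domain c>> &, injective phi}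
    & forall i p, c i = Some p -> phi p.1 = p.2].

Lemma mem_pebbled_domain (k : nat) (gT hT : finGroupType)
    (c : configuration k gT hT) (p : gT * hT) :
  p \in pebbled c -> p.1 \in <<pebbled_domain c>>.
Proof. by move=> cp; apply: mem_gen; rewrite inE; apply: map_f. Qed.

(** Injectivity of [phi] yields well-definedness, and surjectivity is automatic because a morphism
    sends the group generated by a set onto the group generated by its image. *)
Lemma good_markedP (k : nat) (gT hT : finGroupType)
    (c : configuration k gT hT) :
  good VersionII c <-> exists phi, marked_embedding c phi.
Proof.
split=> [[_ [phi [/isomP[inj_phi _] phiE]]]|[phi [phiM phi_inj phiE]]].
  exists phi; split=> [||i p ci]; first exact: morphM.
    by move/injmP: inj_phi.
  have [j ej] := tnth_pebbled ci.
  by move: (phiE j); rewrite !tnth_map ej.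
have memD j : tnth (in_tuple (pebbled c)) j \in pebbled c.
  by apply: (mem_tnth j (in_tuple (pebbled c))).
have memG j := mem_pebbled_domain (memD j).
have phiD p : p \in pebbled c -> phi p.1 = p.2.
  by case/mem_pebbled=> i; apply: phiE.
split=> [i j|].
  rewrite !tnth_map -!phiD //; split=> [->//|].
  exact: phi_inj.
exists (Morphism phiM); split=> [|i]; last by rewrite !tnth_map /= phiD.
apply/isomP; split; first exact/injmP.
rewrite morphim_gen /=; last exact: subset_gen.
congr <<_>>; rewrite morphimEsub /=; last exact: subset_gen.
apply/setP=> y; rewrite inE; apply/imsetP/mapP => [[x]|[p cp ->]].
  by rewrite inE => /mapP[p cp ->] ->; exists p; rewrite ?phiD.
by exists p.1; [rewrite inE; apply: map_f | rewrite phiD].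
Qed.

Lemma good_marked_lift (k : nat) (gT hT : finGroupType)
    (c : configuration k gT hT) (P : {set 'I_k}) :
  good VersionII c -> good VersionII (lift_pebbles P c).
Proof.
have liftE i p : lift_pebbles P c i = Some p -> c i = Some p.
  by rewrite /lift_pebbles; case: ifP.
case/good_markedP=> phi [phiM phi_inj phiE]; apply/good_markedP; exists phi.
have sub : {subset <<pebbled_domain (lift_pebbles P c)>>
                   <= <<pebbled_domain c>>}.
  apply/subsetP/genS/subsetP=> x; rewrite !inE => /mapP[p].
  case/mem_pebbled=> i /liftE ci ->; apply: map_f.
  by apply/mem_pebbled; exists i.
split=> [||i p /liftE]; last exact: phiE.
  by move=> x y /sub Gx /sub Gy; apply: phiM.
by move=> x y /sub Gx /sub Gy; apply: phi_inj.
Qed.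

Lemma good_marked_partial (k : nat) (gT hT : finGroupType)
    (c : configuration k gT hT) : good VersionII c -> good VersionI c.
Proof.
move=> goodc; have [wd _] := goodc; split=> // i j l.
case/good_markedP: goodc => phi [phiM phi_inj phiE].
have memD t : tnth (in_tuple (pebbled c)) t \in pebbled c.
  by apply: (mem_tnth t (in_tuple (pebbled c))).
have memG t := mem_pebbled_domain (memD t).
have phiD t : phi (tnth (in_tuple (pebbled c)) t).1
              = (tnth (in_tuple (pebbled c)) t).2.
  by case/mem_pebbled: (memD t) => u; apply: phiE.
rewrite !tnth_map -!phiD -phiM //; split=> [->//|].
by apply: phi_inj; rewrite ?groupM.
Qed.

Lemma good_partial_eq (k : nat) (gT hT : finGroupType)
    (c : configuration k gT hT) i j p q :
  good VersionI c -> c i = Some p -> c j = Some q -> p.1 = q.1 -> p.2 = q.2.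
Proof.
move=> [wd _] /tnth_pebbled[a ea] /tnth_pebbled[b eb].
by move: (wd a b); rewrite !tnth_map ea eb => -[].
Qed.

Lemma good_partial_mul (k : nat) (gT hT : finGroupType)
    (c : configuration k gT hT) i j l p q s :
  good VersionI c -> c i = Some p -> c j = Some q -> c l = Some s ->
  p.1 * q.1 = s.1 -> p.2 * q.2 = s.2.
Proof.
move=> [_ mu] /tnth_pebbled[a ea] /tnth_pebbled[b eb] /tnth_pebbled[d ed].
by move: (mu a b d); rewrite !tnth_map ea eb ed => -[].
Qed.

(** * Strategies versus round-by-round quantifiers *)

Fixpoint wins_within (k : nat) (gT hT : finGroupType) (J : version) (n : nat)
    (c : configuration k gT hT) : Prop :=
  if n is n'.+1 then
    exists2 P : {set 'I_k}, 1 <= #|P| <= 2 &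
      forall f : {ffun gT -> hT}, bijective f ->
        exists v, ~ good J (lift_pebbles P c) \/
                  wins_within J n' (place_pebbles P v f (lift_pebbles P c))
  else ~ good J c.

Lemma wins_play_within (k : nat) (gT hT : finGroupType) (J : version)
    (s : strategy k gT hT) (n : nat) (c : configuration k gT hT)
    (past : seq {ffun gT -> hT}) :
  (forall fs : seq {ffun gT -> hT}, size fs = n ->
     (forall f : {ffun gT -> hT}, f \in fs -> bijective f) ->
     wins_play J s c past fs) ->
  wins_within J n c.
Proof.
elim: n c past => [|n IHn] c past win /=; first exact: (win [::]).
exists (pick_up s past) => [|f bij_f]; first exact: card_pick_up.
exists (put s (rcons past f)).
(* For each future [win] gives a disjunction, but this check does not depend on the future, so one
   side can be fixed for all of them. *)
have [goodc|] := classic (good J (lift_pebbles (pick_up s past) c)); last by left.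
right; apply: (IHn _ (rcons past f)) => fs szfs bij_fs.
have /win[|//|//] : size (f :: fs) = n.+1 by rewrite /= szfs.
by move=> g; rewrite inE => /predU1P[->|/bij_fs].
Qed.

Lemma strategy_exists (k : nat) (gT hT : finGroupType) :
  0 < k -> exists s : strategy k gT hT, True.
Proof.
move=> k_gt0.
have card1 (past : seq {ffun gT -> hT}) : 1 <= #|[set Ordinal k_gt0]| <= 2.
  by rewrite cards1.
by exists (Strategy (fun _ _ => 1) card1).
Qed.

Definition compose_pick_up (k : nat) (gT hT : finGroupType) (P : {set 'I_k})
    (S : {ffun gT -> hT} -> strategy k gT hT)
    (past : seq {ffun gT -> hT}) : {set 'I_k} :=
  if past is f :: past' then pick_up (S f) past' else P.

(** Since [put] also sees the current bijection, a history of length one means the first round; the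
    empty history never reaches [put], so its value is a dummy. *)
Definition compose_put (k : nat) (gT hT : finGroupType)
    (v : {ffun gT -> hT} -> 'I_k -> gT)
    (S : {ffun gT -> hT} -> strategy k gT hT)
    (past : seq {ffun gT -> hT}) : 'I_k -> gT :=
  match past with
  | [::] => fun=> 1
  | [:: f] => v f
  | f :: past' => put (S f) past'
  end.

Lemma card_compose_pick_up (k : nat) (gT hT : finGroupType) (P : {set 'I_k})
    (S : {ffun gT -> hT} -> strategy k gT hT) :
  1 <= #|P| <= 2 -> forall past, 1 <= #|compose_pick_up P S past| <= 2.
Proof. by move=> cardP [|f past] //=; apply: card_pick_up. Qed.

Definition compose_strategy (k : nat) (gT hT : finGroupType) (P : {set 'I_k})
    (cardP : 1 <= #|P| <= 2) (v : {ffun gT -> hT} -> 'I_k -> gT)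
    (S : {ffun gT -> hT} -> strategy k gT hT) : strategy k gT hT :=
  Strategy (compose_put v S) (card_compose_pick_up S cardP).

Lemma wins_play_compose (k : nat) (gT hT : finGroupType) (P : {set 'I_k})
    (cardP : 1 <= #|P| <= 2) (v : {ffun gT -> hT} -> 'I_k -> gT)
    (S : {ffun gT -> hT} -> strategy k gT hT) J c f past future :
  wins_play J (S f) c past future ->
  wins_play J (compose_strategy cardP v S) c (f :: past) future.
Proof.
elim: future c past => //= g future IH c past [?|win]; first by left.
by right; apply: IH; case: past win.
Qed.

Lemma wins_within_strategy (k : nat) (gT hT : finGroupType) (J : version)
    (n : nat) (c : configuration k gT hT) :
  0 < k -> wins_within J n c ->
  exists s : strategy k gT hT,
    forall fs : seq {ffun gT -> hT}, size fs = n ->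
      (forall f : {ffun gT -> hT}, f \in fs -> bijective f) ->
      wins_play J s c [::] fs.
Proof.
move=> k_gt0; have [s0 _] := strategy_exists gT hT k_gt0.
elim: n c => [|n IHn] c /=; first by move=> win; exists s0 => -[].
case=> P cardP win.
(* The bijections range over a finite type, so finite choice collects Spoiler's replies. Bijectivity
   is kept as a premise inside the existential, which lets a dummy reply serve for the other
   functions. *)
have /fin_all_exists[vs vsP] (f : {ffun gT -> hT}) :
    exists vs : ('I_k -> gT) * strategy k gT hT, bijective f ->
      ~ good J (lift_pebbles P c) \/
      forall fs : seq {ffun gT -> hT}, size fs = n ->
        (forall g : {ffun gT -> hT}, g \in fs -> bijective g) ->
        wins_play J vs.2 (place_pebbles P vs.1 f (lift_pebbles P c)) [::] fs.
  have [bij_f|] := classic (bijective f); last by exists (fun=> 1, s0).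
  have [v [?|/IHn[s sP]]] := win f bij_f; first by exists (v, s0); left.
  by exists (v, s); right.
exists (compose_strategy cardP (fun f => (vs f).1) (fun f => (vs f).2)).
case=> // f fs [szfs] bij_fs /=.
have [|?|winfs] := vsP f; [by apply: bij_fs; rewrite mem_head | by left | right].
apply: (@wins_play_compose _ _ _ _ cardP _ (fun f => (vs f).2)).
by apply: winfs => // g fs_g; apply: bij_fs; rewrite inE fs_g orbT.
Qed.

(** * Comparison of the two versions *)

Lemma wins_play_marked (k : nat) (gT hT : finGroupType)
    (s : strategy k gT hT) c past future :
  wins_play VersionI s c past future -> wins_play VersionII s c past future.
Proof.
elim: future c past => [|f future IH] c past /=.
  by move=> bad /good_marked_partial.
by case=> [bad|/IH]; [left=> /good_marked_partial | right].
Qed.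

(* Badness that is still visible after Spoiler picks up a pebble pair in order
   to have it checked in a further round. *)
Definition robustly_bad (k : nat) (gT hT : finGroupType)
    (c : configuration k gT hT) : Prop :=
  exists2 S : seq 'I_k, size S <= 3 &
    forall c' : configuration k gT hT, {in S, c' =1 c} -> ~ good VersionI c'.

Lemma robustly_bad_wins (k : nat) (gT hT : finGroupType) (n : nat)
    (c : configuration k gT hT) :
  3 < k -> robustly_bad c -> wins_within VersionI n c.
Proof.
move=> k_gt3 [S szS bad]; case: n => [|n] /=; first exact: bad.
have [i Si] : exists i, i \notin S.
  apply/existsP; apply: contraTT k_gt3; rewrite negb_exists => /forallP allS.
  rewrite -leqNgt -[k]card_ord; apply: leq_trans szS.
  apply: leq_trans (card_size S); apply: subset_leq_card.
  by apply/subsetP=> i _; move: (allS i); rewrite negbK.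
exists [set i] => [|f _]; first by rewrite cards1.
(* The check comes before any placement, so the constant 1 is a dummy. *)
exists (fun=> 1); left; apply: bad => j Sj.
by rewrite /lift_pebbles inE; case: eqP Sj Si => // -> ->.
Qed.

Lemma unmarked_bijection_refuted (k : nat) (gT hT : finGroupType)
    (c : configuration k gT hT) (c2 : configuration (k + 2) gT hT)
    (f : {ffun gT -> hT}) :
  (forall i, c2 (lshift 2 i) = c i) -> ~ good VersionII c -> bijective f ->
  let P := [set rshift k i | i : 'I_2] in
  exists v, robustly_bad (place_pebbles P v f (lift_pebbles P c2)).
Proof.
move=> c2E bad bij_f P; apply: NNPP => noSpoil; apply: bad; apply/good_markedP.
pose a : 'I_(k + 2) := rshift k ord0; pose b : 'I_(k + 2) := rshift k ord_max.
pose v x y i := if i == a then x else y : gT.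
pose d x y := place_pebbles P (v x y) f (lift_pebbles P c2).
have da x y : d x y a = Some (x, f x).
  by rewrite /d /place_pebbles imset_f // /v eqxx.
have db x y : d x y b = Some (y, f y).
  by rewrite /d /place_pebbles imset_f // /v eq_rshift.
have dc x y i : d x y (lshift 2 i) = c i.
  rewrite /d /place_pebbles /lift_pebbles; case: imsetP => // -[j _ /eqP].
  by rewrite eq_lrshift.
(* Any three pebbles of [d x y] can be treated as part of a good configuration, so every identity
   below may use at most three. *)
have safe x y (S : seq 'I_(k + 2)) : size S <= 3 ->
    exists2 c', {in S, c' =1 d x y} & good VersionI c'.
  move=> szS; apply: NNPP => noc; apply: noSpoil; exists (v x y); exists S => //.
  by move=> c' eq_c' goodc'; apply: noc; exists c'.
(* The relation 1 * 1 = 1 makes [f 1] idempotent. *)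
have f1 : f 1 = 1.
  have [//|c' eqc' goodc'] := safe 1 1 [:: a].
  have c'a : c' a = Some (1, f 1) by rewrite eqc' ?da // mem_head.
  have /= := good_partial_mul goodc' c'a c'a c'a (mulg1 _).
  by move/eqP; rewrite -{3}[f 1]mulg1 (inj_eq (mulgI _)) => /eqP.
have fc i p : c i = Some p -> f p.1 = p.2.
  move=> ci; have [//|c' eqc' goodc'] := safe p.1 1 [:: a; lshift 2 i].
  have c'a : c' a = Some (p.1, f p.1) by rewrite eqc' ?da // mem_head.
  have c'i : c' (lshift 2 i) = Some p.
    by rewrite eqc' ?dc ?ci // !inE eqxx orbT.
  exact: (good_partial_eq goodc' c'a c'i).
have fM x i p : c i = Some p -> f (x * p.1) = f x * f p.1.
  move=> ci.
  have [//|c' eqc' goodc'] := safe x (x * p.1) [:: a; b; lshift 2 i].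
  have c'a : c' a = Some (x, f x) by rewrite eqc' ?da // mem_head.
  have c'b : c' b = Some (x * p.1, f (x * p.1)).
    by rewrite eqc' ?db // !inE eqxx orbT.
  have c'i : c' (lshift 2 i) = Some p.
    by rewrite eqc' ?dc ?ci // !inE eqxx !orbT.
  rewrite (fc i p ci); apply/esym.
  exact: (good_partial_mul goodc' c'a c'i c'b (erefl _)).
(* Letting [x] range over the whole group, not just the generated subgroup, makes [Z] closed under
   products; by finiteness this and [f1] make it a subgroup. *)
pose Z := [set z | [forall x, f (x * z) == f x * f z]].
have ZP z : reflect (forall x, f (x * z) = f x * f z) (z \in Z).
  by rewrite inE; apply: 'forall_eqP.
have groupZ : group_set Z.
  apply/group_setP; split=> [|y z /ZP Zy /ZP Zz]; apply/ZP=> x.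
    by rewrite f1 !mulg1.
  by rewrite mulgA Zz Zy Zz mulgA.
have subZ : <<pebbled_domain c>> \subset Group groupZ.
  rewrite gen_subG; apply/subsetP=> x.
  rewrite inE => /mapP[p /mem_pebbled[i ci] ->].
  by apply/ZP=> y; apply: fM ci.
exists f; split=> [x y _ /(subsetP subZ)/ZP->//|x y _ _|//].
exact: bij_inj.
Qed.

Lemma unmarked_wins (k : nat) (gT hT : finGroupType) (n : nat)
    (c : configuration k gT hT) (c2 : configuration (k + 2) gT hT) :
  2 <= k -> (forall i, c2 (lshift 2 i) = c i) -> ~ good VersionII c ->
  wins_within VersionI n.+1 c2.
Proof.
move=> k_ge2 c2E bad; exists [set rshift k i | i : 'I_2] => [|f bij_f].
  by rewrite card_imset ?card_ord //; apply: rshift_inj.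
have [v bad2] := unmarked_bijection_refuted c2E bad bij_f.
(* Here [2 <= k] supplies the fourth pebble pair. *)
by exists v; right; apply: robustly_bad_wins; rewrite // addn2.
Qed.

(** The invariant is that the first [k] pairs of [c2] copy [c]; the spare round is spent on the two
    reserve pairs as soon as the copied position is unmarked. *)
Lemma wins_within_partial (k : nat) (gT hT : finGroupType) (n : nat)
    (c : configuration k gT hT) (c2 : configuration (k + 2) gT hT) :
  2 <= k -> (forall i, c2 (lshift 2 i) = c i) ->
  wins_within VersionII n c -> wins_within VersionI n.+1 c2.
Proof.
move=> k_ge2; elim: n c c2 => [|n IHn] c c2 c2E.
  exact: unmarked_wins.
case=> P cardP win.
(* A violation visible after lifting [P] was present before it, so Spoiler picks up the reserve
   pairs instead of [P] in this very round. *)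
have [goodc|bad] := classic (good VersionII (lift_pebbles P c)); last first.
  by apply: (unmarked_wins _ k_ge2 c2E) => /(good_marked_lift P).
exists [set lshift 2 i | i in P] => [|f bij_f].
  by rewrite card_imset //; apply: lshift_inj.
have [v [//|winv]] := win f bij_f.
(* The reserve pairs are not picked up here, so the value 1 at them is a dummy. *)
exists (fun i => if split i is inl j then v j else 1); right.
apply: IHn winv => i; rewrite /place_pebbles /lift_pebbles.
rewrite mem_imset; last exact: lshift_inj.
by rewrite -/(unsplit (inl i)) unsplitK c2E.
Qed.

Theorem theorem13 (k r : nat) (hk : 2 <= k) (hr : 1 <= r) :
  (forall G H : finGroupType,
     spoiler_wins k r VersionI G H -> spoiler_wins k r VersionII G H) /\
  (forall G H : finGroupType,
     spoiler_wins k r VersionII G H ->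
     spoiler_wins (k + 2) (r + 1) VersionI G H).
Proof.
split=> G H [neqGH|[s win]]; try by left.
  by right; exists s => fs /win; apply: wins_play_marked.
right.
have winII : wins_within VersionII r (@empty_board k G H).
  apply: (@wins_play_within _ _ _ _ s _ _ [::]) => fs /eqP szfs.
  exact: (win (Tuple szfs)).
have /wins_within_strategy[|t winI] :
    wins_within VersionI (r + 1) (@empty_board (k + 2) G H).
- by rewrite addn1; apply: wins_within_partial winII.
- by rewrite addn2.
by exists t => fs; apply: winI; rewrite size_tuple.
Qed.
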